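(* Let $Q$ be a finitely generated quandle, $Q'$ a quandle, $\phi:Q\to Q'$ a quandle homomorphism, and $A$ a $Q'$-quandle which is finite. Then the number of derivations from $Q$ to $A$ (with respect to $\phi$) is finite.
   Context: A quandle is a non-empty set $Q$ with a binary operation $*$ such that (Q1) $q*q=q$ for all $q$; (Q2) for all $q_1,q_2\in Q$ there is a unique $q\in Q$ with $q_2=q*q_1$ (write $q=q_2*^{-1}q_1$); (Q3) $(q_1*q_2)*q_3=(q_1*q_3)*(q_2*q_3)$ for all $q_1,q_2,q_3$. A quandle homomorphism is a map $f$ with $f(q_1*q_2)=f(q_1)*f(q_2)$. A quandle is generated by a subset $S$ if it is the smallest subset containing $S$ closed under $*$ and $*^{-1}$; it is finitely generated if it is generated by some finite subset. The associated group $\operatorname{As}(Q)$ is the group generated by $\{e_q \mid q\in Q\}$ modulo the relations $e_{q_1*q_2}=e_{q_2}e_{q_1}e_{q_2}^{-1}$. A quandle homomorphism $\phi:Q\to Q'$ induces a group homomorphism $\phi:\operatorname{As}(Q)\to\operatorname{As}(Q')$, $\phi(e_q)=e_{\phi(q)}$. A quandle $A$ is a $Q'$-quandle if it is equipped with a (left) action $(g,a)\mapsto g\cdot a$ of $\operatorname{As}(Q')$ on $A$ by quandle automorphisms. Given a quandle homomorphism $\phi:Q\to Q'$ and a $Q'$-quandle $A$, a map $\partial:Q\to A$ is a derivation if $\partial(q_1*q_2)=\partial(q_1)*\big(\phi(e_{q_1})\cdot\partial(q_2)\big)$ for all $q_1,q_2\in Q$. *)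

(* Defs.v *)
From HB Require Import structures.
From mathcomp Require Import all_boot.
From mathcomp Require Import boolp classical_sets cardinality.

Set Implicit Arguments.
Unset Strict Implicit.
Unset Printing Implicit Defensive.

Import Algebra.

Declare Scope quandle_scope.
Delimit Scope quandle_scope with qdl.

Local Open Scope quotient_scope.
Local Open Scope classical_set_scope.

HB.mixin Record isQuandle (Q : Type) := {
  qmul : Q -> Q -> Q;
  quandle_nonempty : inhabited Q;
  qmulxx : forall q, qmul q q = q;
  qmul_unique_div : forall q1 q2, exists! q, q2 = qmul q q1;
  qmul_selfdistr : forall q1 q2 q3,
    qmul (qmul q1 q2) q3 = qmul (qmul q1 q3) (qmul q2 q3)
}.

#[short(type="quandleType")]
HB.structure Definition Quandle := {Q of isQuandle Q}.

(* [(x / y)%qdl] is the operation usually written x *^{-1} y. *)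
Definition qdiv (Q : quandleType) (q2 q1 : Q) : Q :=
  sval (cid (qmul_unique_div q1 q2)).

Notation "x * y" := (qmul x y) : quandle_scope.
Notation "x / y" := (qdiv x y) : quandle_scope.

Lemma qdivK (Q : quandleType) (q1 q2 : Q) : ((q2 / q1) * q1)%qdl = q2.
Proof. by rewrite /qdiv; case: cid => q [/= <-]. Qed.

Lemma qmulK (Q : quandleType) (q1 q : Q) : ((q * q1) / q1)%qdl = q.
Proof. by rewrite /qdiv; case: cid => p [/= _]; apply. Qed.

HB.mixin Record isQuandleMorphism (Q Q' : quandleType) (f : Q -> Q') := {
  qmorphM : {morph f : x y / (x * y)%qdl >-> (x * y)%qdl}
}.

HB.structure Definition QuandleMorphism (Q Q' : quandleType) :=
  {f of isQuandleMorphism Q Q' f}.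

Notation "{ 'quandle_morphism' Q -> Q' }" := (QuandleMorphism.type Q Q')
  (at level 0, Q at level 98, Q' at level 99) : type_scope.

Definition subquandle (Q : quandleType) (X : set Q) : Prop :=
  (forall x y, X x -> X y -> X (x * y)%qdl) /\
  (forall x y, X x -> X y -> X (x / y)%qdl).

Definition quandle_generated_by (Q : quandleType) (S : set Q) : Prop :=
  smallest (@subquandle Q) S = [set: Q].

Definition finitely_generated_quandle (Q : quandleType) : Prop :=
  exists2 S : set Q, finite_set S & quandle_generated_by S.

(* As(Q) is the set of formal group expressions in the symbols e_q, modulo the
   least congruence containing the group axioms and the defining relations. *)
Inductive as_expr (Q : Type) : Type :=
  | AsGen of Q
  | AsOne
  | AsMul of as_expr Q & as_expr Q
  | AsInv of as_expr Q.

Arguments AsOne {Q}.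

Inductive as_congr (Q : quandleType) : as_expr Q -> as_expr Q -> Prop :=
  | as_refl x : as_congr x x
  | as_sym x y : as_congr x y -> as_congr y x
  | as_trans x y z : as_congr x y -> as_congr y z -> as_congr x z
  | as_congrM x x' y y' :
      as_congr x x' -> as_congr y y' -> as_congr (AsMul x y) (AsMul x' y')
  | as_congrV x x' : as_congr x x' -> as_congr (AsInv x) (AsInv x')
  | as_mulA x y z : as_congr (AsMul x (AsMul y z)) (AsMul (AsMul x y) z)
  | as_mul1 x : as_congr (AsMul AsOne x) x
  | as_mulx1 x : as_congr (AsMul x AsOne) x
  | as_mulV x : as_congr (AsMul (AsInv x) x) AsOne
  | as_mulxV x : as_congr (AsMul x (AsInv x)) AsOne
  | as_relation q1 q2 :
      as_congr (AsGen (q1 * q2)%qdl)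
               (AsMul (AsMul (AsGen q2) (AsGen q1)) (AsInv (AsGen q2))).

HB.instance Definition _ (Q : Type) := gen_eqMixin (as_expr Q).
HB.instance Definition _ (Q : Type) := gen_choiceMixin (as_expr Q).

Section AssociatedGroup.
Variable Q : quandleType.
Implicit Types x y : as_expr Q.

Definition as_equiv : rel (as_expr Q) := fun x y => `[< as_congr x y >].

Fact as_equiv_refl : reflexive as_equiv.
Proof. by move=> x; apply/asboolP/as_refl. Qed.

Fact as_equiv_sym : symmetric as_equiv.
Proof. by move=> x y; apply/asboolP/asboolP => /as_sym. Qed.

Fact as_equiv_trans : transitive as_equiv.
Proof.
by move=> y x z /asboolP xy /asboolP yz; apply/asboolP/(as_trans xy yz).
Qed.

Canonical as_equivRel :=
  EquivRel as_equiv as_equiv_refl as_equiv_sym as_equiv_trans.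

Definition As : Type := {eq_quot as_equiv}.

HB.instance Definition _ := Choice.on As.
HB.instance Definition _ := EqQuotient.on As.

Lemma as_piP x y : \pi_As x = \pi_As y <-> as_congr x y.
Proof. by split=> [/eqmodP/asboolP | xy]; last exact/eqmodP/asboolP. Qed.

Lemma as_reprK x : as_congr (repr (\pi_As x)) x.
Proof. by apply/as_piP; rewrite reprK. Qed.

Definition As_one : As := \pi_As AsOne.
Definition As_mul (a b : As) : As := \pi_As (AsMul (repr a) (repr b)).
Definition As_inv (a : As) : As := \pi_As (AsInv (repr a)).

Lemma As_mulE x y : As_mul (\pi_As x) (\pi_As y) = \pi_As (AsMul x y).
Proof. by apply/as_piP/as_congrM; exact: as_reprK. Qed.

Lemma As_invE x : As_inv (\pi_As x) = \pi_As (AsInv x).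
Proof. by apply/as_piP/as_congrV; exact: as_reprK. Qed.

Fact As_mulA : associative As_mul.
Proof.
elim/quotW => x; elim/quotW => y; elim/quotW => z.
by rewrite (As_mulE y) (As_mulE x y) !As_mulE; apply/as_piP; exact: as_mulA.
Qed.

Fact As_mul1g : left_id As_one As_mul.
Proof. by elim/quotW => x; rewrite As_mulE; apply/as_piP; exact: as_mul1. Qed.

Fact As_mulg1 : right_id As_one As_mul.
Proof. by elim/quotW => x; rewrite As_mulE; apply/as_piP; exact: as_mulx1. Qed.

Fact As_mulVg : left_inverse As_one As_inv As_mul.
Proof.
by elim/quotW => x; rewrite As_invE As_mulE; apply/as_piP; exact: as_mulV.
Qed.

Fact As_mulgV : right_inverse As_one As_inv As_mul.
Proof.
by elim/quotW => x; rewrite As_invE As_mulE; apply/as_piP; exact: as_mulxV.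
Qed.

HB.instance Definition _ :=
  isGroup.Build As As_mulA As_mul1g As_mulg1 As_mulVg As_mulgV.

Definition as_gen (q : Q) : As := \pi_As (AsGen q).

Lemma as_gen_relation (q1 q2 : Q) :
  as_gen (q1 * q2)%qdl = (as_gen q2 * as_gen q1 * (as_gen q2)^-1)%g.
Proof.
rewrite -[RHS]/(As_mul (As_mul (as_gen q2) (as_gen q1)) (As_inv (as_gen q2))).
rewrite (As_mulE (AsGen q2)) (As_invE (AsGen q2)) As_mulE.
by apply/as_piP; exact: as_relation.
Qed.

Section UniversalProperty.
Variables (G : groupType) (f : Q -> G).
Hypothesis f_relation :
  forall q1 q2 : Q, f (q1 * q2)%qdl = (f q2 * f q1 * (f q2)^-1)%g.

Fixpoint as_eval (x : as_expr Q) : G :=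
  match x with
  | AsGen q => f q
  | AsOne => 1%g
  | AsMul y z => (as_eval y * as_eval z)%g
  | AsInv y => (as_eval y)^-1%g
  end.

Lemma as_eval_congr x y : as_congr x y -> as_eval x = as_eval y.
Proof.
elim=> //= {x y} [x y z _ -> _ -> | x x' y y' _ -> _ -> | x x' _ ->
  | x y z | x | x | x | x] //.
- by rewrite mulgA.
- by rewrite mul1g.
- by rewrite mulg1.
- by rewrite mulVg.
- by rewrite mulgV.
Qed.

Definition as_lift (a : As) : G := as_eval (repr a).

Lemma as_lift_gen q : as_lift (as_gen q) = f q.
Proof. exact: as_eval_congr (as_reprK _). Qed.

Fact as_lift_is_multiplicative : {morph as_lift : a b / (a * b)%g}.
Proof. by move=> a b; exact: as_eval_congr (as_reprK _). Qed.

Lemma as_lift_unique (h : {multiplicative As -> G}) :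
  (forall q, h (as_gen q) = f q) -> h =1 as_lift.
Proof.
have h1 : h 1%g = 1%g by apply: (mulgI (h 1%g)); rewrite -gmulfM !mulg1.
move=> hf; elim/quotW => x; rewrite /as_lift (as_eval_congr (as_reprK x)).
elim: x => [q | | x IHx y IHy | x IHx] /=.
- exact: hf.
- exact: h1.
- by rewrite -As_mulE -IHx -IHy -gmulfM.
- apply: (mulgI (as_eval x)); rewrite mulgV -IHx -As_invE -gmulfM.
  rewrite -[As_inv _]/((\pi_As x : As)^-1%g) mulgV; exact: h1.
Qed.

End UniversalProperty.

End AssociatedGroup.

Section InducedMorphism.
Variables (Q Q' : quandleType) (phi : {quandle_morphism Q -> Q'}).

Definition as_map : As Q -> As Q' := as_lift (fun q => as_gen (phi q)).

Fact as_map_relation (q1 q2 : Q) :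
  as_gen (phi (q1 * q2)%qdl)
    = (as_gen (phi q2) * as_gen (phi q1) * (as_gen (phi q2))^-1)%g.
Proof. by rewrite qmorphM as_gen_relation. Qed.

HB.instance Definition _ := isMultiplicative.Build (As Q) (As Q') as_map
  (as_lift_is_multiplicative as_map_relation).

Lemma as_map_gen (q : Q) : as_map (as_gen q) = as_gen (phi q).
Proof. exact (as_lift_gen as_map_relation q). Qed.

End InducedMorphism.

HB.mixin Record isQuandleOver (Q' : quandleType) (A : Type) of Quandle A := {
  qact : As Q' -> A -> A;
  qact1 : forall a, qact 1%g a = a;
  qactM : forall g h a, qact (g * h)%g a = qact g (qact h a);
  qact_morph : forall g, {morph qact g : a b / (a * b)%qdl}
}.

#[short(type="quandleOverType")]
HB.structure Definition QuandleOver (Q' : quandleType) :=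
  {A of isQuandleOver Q' A & Quandle A}.

Lemma qact_bij (Q' : quandleType) (A : quandleOverType Q') (g : As Q') :
  bijective (@qact Q' A g).
Proof.
by exists (qact g^-1%g) => a; rewrite -qactM (mulVg, mulgV) qact1.
Qed.

Definition derivation (Q Q' : quandleType) (phi : {quandle_morphism Q -> Q'})
    (A : quandleOverType Q') (d : Q -> A) : Prop :=
  forall q1 q2 : Q,
    d (q1 * q2)%qdl = (d q1 * qact (as_map phi (as_gen q1)) (d q2))%qdl.

(* Main.v *)
(** A derivation is determined by its values on a generating set: the points
    where two derivations agree form a subquandle, closure under [/] because
    right translations of [A] are injective. Restriction to a finite generating
    set [S] thus embeds the derivations into the finite set of maps [S -> A]. *)

Require Import Defs.
From mathcomp Require Import all_boot boolp classical_sets cardinality.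

Local Open Scope classical_set_scope.

Lemma finite_set_determined (T U : Type) (S : set T) (D : set (T -> U)) :
  finite_set S -> finite_set [set: U] ->
  (forall f g, D f -> D g -> (forall x, S x -> f x = g x) -> f = g) ->
  finite_set D.
Proof.
move=> /(@finite_seqP {classic T})[s ->]
  [m /card_set_bijP[c [cm /in2TT c_inj _]]] D_inj.
(* [inord] needs a nonempty ordinal type, and [m] is 0 when [U] is empty; hence ['I_m.+1]. *)
pose code (f : T -> U) : {ffun 'I_(size s) -> 'I_m.+1} :=
  [ffun i => inord (c (f (tnth (in_tuple s) i)))].
have code_inj : {in D &, injective code}.
  move=> f g /set_mem Df /set_mem Dg /ffunP fg; apply: D_inj => // x /= xs.
  have /tnthP[i ->] : (x : {classic T}) \in in_tuple s by [].
  (* This bound keeps [inord] off its default value, so codes determine [c]. *)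
  have cP y : c y < m.+1 by apply/ltnW; exact: cm.
  by apply/c_inj; have /(congr1 val) := fg i; rewrite !ffunE /= !inordK.
have := inj_card_eq code_inj; rewrite card_eq_le => /andP[_ le_D].
exact: card_le_finite le_D finite_finset.
Qed.

Lemma qmul_injl (Q : quandleType) (q : Q) : injective (qmul^~ q).
Proof. by move=> x y /(congr1 (fun z => z / q)%qdl); rewrite !qmulK. Qed.

Lemma subquandle_derivation_eq (Q Q' : quandleType)
    (phi : {quandle_morphism Q -> Q'}) (A : quandleOverType Q') (d e : Q -> A) :
  derivation phi d -> derivation phi e -> subquandle [set q | d q = e q].
Proof.
move=> dD eD; split=> x y /= dex dey; first by rewrite dD eD dex dey.
(* With [x] written as [(x / y) * y], the acting group element depends on [x / y] alone, not on [d]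
   or [e]; so the right factors coincide by [dey] and cancel. *)
by move: dex; rewrite -{1 2}[x](qdivK y) dD eD dey => /qmul_injl.
Qed.

Theorem corollary3p7 (Q Q' : quandleType) (phi : {quandle_morphism Q -> Q'})
    (A : quandleOverType Q') :
  finitely_generated_quandle Q ->
  finite_set [set: A] ->
  finite_set [set d : Q -> A | derivation phi d].
Proof.
move=> [S finS genS] finA.
apply: finite_set_determined finS finA _ => d e dD eD deS.
have eqS : smallest (@subquandle Q) S `<=` [set q | d q = e q].
  by apply: smallest_sub => //; exact: subquandle_derivation_eq dD eD.
by apply/funext => q; apply: eqS; rewrite genS.
Qed.
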